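(* Let $R>0$ be real and let $\omega$ be a complex-valued function analytic in the disk $\{k\in\mathbb{C}: |k|<R\}$, with Taylor series $\omega(k)=\sum_{n=0}^\infty a_n k^n$. Suppose that $\operatorname{Im}\omega(k)\le |\operatorname{Im} k|$ for all $k$ with $|k|<R$. Then $\operatorname{Im}(a_0)\le 0$, and for every integer $n>0$, with $\theta_n=\arg(a_n)$, $$|a_n|\le \frac{2(n^2-1)-(1+(-1)^n)\sin\theta_n}{n^2-1}\,\frac{2}{\pi R^{n-1}}-\frac{2\operatorname{Im}(a_0)}{R^n},$$ where for $n=1$ the first fraction is understood to equal $2$.
   Context: $\arg(a_n)$ denotes any real number $\theta_n$ with $a_n=|a_n|e^{i\theta_n}$ (if $a_n=0$, any real $\theta_n$ may be chosen). For odd $n$ the factor $1+(-1)^n$ vanishes, so that for odd $n>1$ the first fraction equals $2$. *)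

(* Defs.v *)
From Stdlib Require Import Reals.
From Coquelicot Require Import Coquelicot.
Open Scope R_scope.

(* Coquelicot also views C as a real normed space; here the scalars are C
   itself, so differentiability is complex differentiability. *)
Definition analytic_on_disk (omega : C -> C) (rho : R) : Prop :=
  forall k : C, Cmod k < rho ->
    ex_derive (K := C_AbsRing) (V := C_NormedModule) omega k.

Definition taylor_on_disk (a : nat -> C) (omega : C -> C) (rho : R) : Prop :=
  forall k : C, Cmod k < rho ->
    is_pseries (K := C_AbsRing) (V := C_NormedModule) a k (omega k).

Definition expi (theta : R) : C := (cos theta, sin theta).

(* A relation, since the argument is multivalued: every real is an argument
   of 0. *)
Definition is_arg (z : C) (theta : R) : Prop :=
  z = (RtoC (Cmod z) * expi theta)%C.

(* At n = 1 the quotient is 0 / 0 and is read as 2, its value at every other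
   odd n. *)
Definition first_fraction (n : nat) (theta : R) : R :=
  if Nat.eqb n 1 then 2
  else (2 * (INR n ^ 2 - 1) - (1 + (-1) ^ n) * sin theta) / (INR n ^ 2 - 1).

(* Main.v *)
(** Integrating [Im omega (r e^(i phi))] against the nonnegative kernel
    [1 + sin (n phi + theta)] over [0, 2 pi] gives
    [2 pi Im a_0 + pi |a_n| r^n]; by hypothesis it is at most the integral of
    [r |sin phi| (1 + sin (n phi + theta))], which is explicit. Then [r]
    tends to [rho]. Termwise integration is avoided: only a Taylor partial sum
    is integrated, as it already satisfies the bound up to [eps], uniformly in
    [phi]. *)
Require Import Defs.
From Stdlib Require Import Reals Lra Lia ZArith Bool.
From Coquelicot Require Import Coquelicot.
Open Scope R_scope.

(** * Complex series by components, and polar form *)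

(** Complex partial sums are componentwise and balls in [C] are products of balls, so a
    neighbourhood of one component pulls back to a neighbourhood in [C]. *)
Lemma is_series_C_components (u : nat -> C) (l : C) :
  is_series (K := C_AbsRing) (V := C_NormedModule) u l ->
  is_series (fun m => Re (u m)) (Re l) /\ is_series (fun m => Im (u m)) (Im l).
Proof.
  intros H.
  assert (E : forall N,
    sum_n (G := C_NormedModule) u N =
    (sum_n (fun m => Re (u m)) N, sum_n (fun m => Im (u m)) N)).
  { induction N as [|N IH].
    - rewrite !sum_O. apply surjective_pairing.
    - rewrite !sum_Sn, IH. reflexivity. }
  split; intros P [eps HP]; unfold filtermap.
  - destruct (H (fun z => ball (Re l) eps (Re z))) as [N HN].
    { exists eps. intros z [Hz _]. exact Hz. }
    exists N. intros m Hm. apply HP.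
    specialize (HN m Hm). rewrite E in HN. exact HN.
  - destruct (H (fun z => ball (Im l) eps (Im z))) as [N HN].
    { exists eps. intros z [_ Hz]. exact Hz. }
    exists N. intros m Hm. apply HP.
    specialize (HN m Hm). rewrite E in HN. exact HN.
Qed.

Lemma is_lim_seq_bounded (u : nat -> R) (l : R) :
  is_lim_seq u l -> exists M, 0 <= M /\ forall m, Rabs (u m) <= M.
Proof.
  intros H. apply is_lim_seq_Reals in H.
  destruct (maj_by_pos u (exist _ l H)) as [M [HM HB]].
  exists M. split; [lra | exact HB].
Qed.

Lemma pow_n_polar (r phi : R) (m : nat) :
  pow_n (K := C_AbsRing) (RtoC r * expi phi)%C m =
  (RtoC (r ^ m) * expi (INR m * phi))%C.
Proof.
  induction m as [|m IH].
  - unfold expi. simpl INR. rewrite Rmult_0_l, cos_0, sin_0. simpl.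
    apply injective_projections; simpl; ring.
  - transitivity ((RtoC r * expi phi) * (RtoC (r ^ m) * expi (INR m * phi)))%C.
    { rewrite <- IH. reflexivity. }
    rewrite S_INR. unfold expi.
    replace ((INR m + 1) * phi) with (phi + INR m * phi) by ring.
    rewrite cos_plus, sin_plus.
    apply injective_projections; simpl; ring.
Qed.

Lemma Cmod_polar (r phi : R) :
  0 <= r -> Cmod (RtoC r * expi phi)%C = r.
Proof.
  intros Hr. rewrite Cmod_mult, Cmod_R, (Rabs_pos_eq r Hr).
  unfold Cmod, expi; simpl.
  replace (cos phi * (cos phi * 1) + sin phi * (sin phi * 1)) with 1.
  - rewrite sqrt_1. ring.
  - generalize (sin2_cos2 phi). unfold Rsqr. lra.
Qed.

(** * Uniform approximation by Taylor partial sums on a circle *)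

(** The imaginary part of the degree-[m] Taylor term at [r e^(i phi)]. *)
Definition im_term (a : nat -> C) (r phi : R) (m : nat) : R :=
  r ^ m * (Re (a m) * sin (INR m * phi) + Im (a m) * cos (INR m * phi)).

Lemma is_series_im_term (a : nat -> C) (omega : C -> C) (rho r phi : R) :
  taylor_on_disk a omega rho -> 0 <= r < rho ->
  is_series (im_term a r phi) (Im (omega (RtoC r * expi phi)%C)).
Proof.
  intros HT Hr.
  assert (Hk : Cmod (RtoC r * expi phi)%C < rho) by (rewrite Cmod_polar; lra).
  destruct (is_series_C_components _ _ (HT _ Hk)) as [_ H].
  eapply is_series_ext; [|exact H].
  intros m. cbv beta. rewrite pow_n_polar. unfold im_term, expi.
  destruct (a m) as [p q]. simpl. ring.
Qed.

(** The terms of a convergent series tend to 0 and so are bounded. Convergence is used at the point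
    of angle 0, where the components of the term are just [s ^ m] times those of [a m]. *)
Lemma taylor_coef_bounded (a : nat -> C) (omega : C -> C) (rho s : R) :
  taylor_on_disk a omega rho -> 0 <= s < rho ->
  exists M, 0 <= M /\
    forall m, s ^ m * (Rabs (Re (a m)) + Rabs (Im (a m))) <= M.
Proof.
  intros HT Hs.
  assert (Hk : Cmod (RtoC s * expi 0)%C < rho) by (rewrite Cmod_polar; lra).
  destruct (is_series_C_components _ _ (HT _ Hk)) as [H1 H2].
  destruct (is_lim_seq_bounded _ _ (ex_series_lim_0 _ (ex_intro _ _ H1)))
    as [M1 [P1 B1]].
  destruct (is_lim_seq_bounded _ _ (ex_series_lim_0 _ (ex_intro _ _ H2)))
    as [M2 [P2 B2]].
  exists (M1 + M2). split; [lra|]. intros m.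
  specialize (B1 m); specialize (B2 m); cbv beta in B1, B2.
  rewrite pow_n_polar, Rmult_0_r in B1, B2.
  unfold expi in B1, B2. rewrite cos_0, sin_0 in B1, B2.
  destruct (a m) as [p q]. simpl in B1, B2 |- *.
  replace ((s ^ m * 1 - 0 * 0) * p - (s ^ m * 0 + 0 * 1) * q)
    with (s ^ m * p) in B1 by ring.
  replace ((s ^ m * 1 - 0 * 0) * q + (s ^ m * 0 + 0 * 1) * p)
    with (s ^ m * q) in B2 by ring.
  assert (0 <= s ^ m) by (apply pow_le; lra).
  rewrite Rabs_mult, (Rabs_pos_eq (s ^ m)) in B1, B2 by assumption. lra.
Qed.

(** The remainder is the sum of the shifted series, dominated termwise by a geometric series with
    first term [M * q ^ S N]. *)
Lemma is_series_geom_tail (u : nat -> R) (l M q : R) (N : nat) :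
  0 <= q < 1 -> (forall m, Rabs (u m) <= M * q ^ m) -> is_series u l ->
  Rabs (l - sum_n u N) <= M * q ^ S N / (1 - q).
Proof.
  intros Hq Hu Hl.
  assert (Hs : is_series (fun m => u (S N + m)%nat) (l - sum_n u N)).
  { apply (is_series_incr_n _ (S N)); [lia|].
    match goal with |- is_series _ ?w => replace w with l end; [exact Hl|].
    change (l = l - sum_n u N + sum_n u N). ring. }
  assert (Hg : is_series (fun m => M * q ^ S N * q ^ m)
                 (M * q ^ S N * / (1 - q))).
  { apply (is_series_scal (K := R_AbsRing) (V := R_NormedModule)).
    apply is_series_geom. rewrite Rabs_pos_eq; lra. }
  assert (Hb : forall m, Rabs (u (S N + m)%nat) <= M * q ^ S N * q ^ m).
  { intros m. eapply Rle_trans; [apply Hu|].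
    rewrite pow_add. right; ring. }
  assert (He : ex_series (fun m => Rabs (u (S N + m)%nat))).
  { eapply (ex_series_le (K := R_AbsRing) (V := R_CompleteNormedModule));
      [|eexists; exact Hg].
    intros m. unfold norm; simpl; unfold abs; simpl.
    rewrite Rabs_Rabsolu. apply Hb. }
  rewrite <- (is_series_unique _ _ Hs).
  eapply Rle_trans; [apply Series_Rabs; exact He|].
  unfold Rdiv. rewrite <- (is_series_unique _ _ Hg).
  apply Series_le; [|eexists; exact Hg].
  intros m. split; [apply Rabs_pos | apply Hb].
Qed.

(** Boundedness at an intermediate radius [s] forces decay like [(r / s) ^ m] at radius [r], with a
    constant free of [phi]; hence one [N] serves all angles. Asking for [n <= N] keeps the
    degree-[n] term in the sum. *)
Lemma im_term_partial_sum_le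
  (a : nat -> C) (omega : C -> C) (rho r eps : R) (n : nat) :
  taylor_on_disk a omega rho ->
  (forall k : C, Cmod k < rho -> Im (omega k) <= Rabs (Im k)) ->
  0 < r < rho -> 0 < eps ->
  exists N, (n <= N)%nat /\
    forall phi, sum_n (im_term a r phi) N <= r * Rabs (sin phi) + eps.
Proof.
  intros HT Him Hr Heps.
  set (s := (r + rho) / 2).
  assert (Hs : r < s < rho) by (unfold s; lra).
  destruct (taylor_coef_bounded a omega rho s HT) as [M [HM HB]]; [lra|].
  set (q := r / s).
  assert (Hq : 0 <= q < 1).
  { unfold q. split; [apply Rdiv_le_0_compat; lra|].
    apply (Rmult_lt_reg_r s); [lra|]. unfold Rdiv.
    rewrite Rmult_assoc, Rinv_l; lra. }
  assert (Hb : forall phi m, Rabs (im_term a r phi m) <= M * q ^ m).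
  { intros phi m. unfold im_term.
    replace r with (s * q) by (unfold q; field; lra).
    rewrite Rpow_mult_distr, !Rabs_mult.
    assert (0 <= s ^ m) by (apply pow_le; lra).
    assert (Q : 0 <= q ^ m) by (apply pow_le; lra).
    rewrite (Rabs_pos_eq (s ^ m)), (Rabs_pos_eq (q ^ m)) by assumption.
    rewrite (Rmult_comm (s ^ m)), Rmult_assoc, Rmult_comm.
    apply Rmult_le_compat_r; [assumption|].
    eapply Rle_trans; [|apply (HB m)].
    apply Rmult_le_compat_l; [assumption|].
    eapply Rle_trans; [apply Rabs_triang|]. rewrite !Rabs_mult.
    assert (Rabs (sin (INR m * phi)) <= 1)
      by (apply Rabs_le, SIN_bound).
    assert (Rabs (cos (INR m * phi)) <= 1)
      by (apply Rabs_le, COS_bound).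
    generalize (Rabs_pos (Re (a m))) (Rabs_pos (Im (a m))). nra. }
  (* This threshold brings the geometric tail below [eps]; [M + 1] instead of [M] keeps the divisor
     nonzero. *)
  destruct (pow_lt_1_zero q) with (y := eps * (1 - q) / (M + 1)) as [N0 HN0].
  { rewrite Rabs_pos_eq; lra. }
  { apply Rdiv_lt_0_compat; [apply Rmult_lt_0_compat; lra | lra]. }
  exists (n + N0)%nat. split; [lia|]. intros phi.
  assert (Hq1 : q ^ S (n + N0) <= eps * (1 - q) / (M + 1)).
  { left. eapply Rle_lt_trans; [apply Rle_abs|]. apply HN0. lia. }
  assert (Hq2 : M * q ^ S (n + N0) / (1 - q) <= eps).
  { apply (Rmult_le_reg_r (1 - q)); [lra|].
    unfold Rdiv at 1. rewrite Rmult_assoc, Rinv_l, Rmult_1_r by lra.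
    assert (E : eps * (1 - q) = (M + 1) * (eps * (1 - q) / (M + 1)))
      by (field; lra).
    assert (0 <= q ^ S (n + N0)) by (apply pow_le; lra).
    rewrite E. apply Rmult_le_compat; lra. }
  assert (HS := is_series_geom_tail _ _ M q (n + N0) Hq (Hb phi)
    (is_series_im_term a omega rho r phi HT ltac:(lra))).
  assert (HI := Him (RtoC r * expi phi)%C ltac:(rewrite Cmod_polar; lra)).
  replace (Im (RtoC r * expi phi)%C) with (r * sin phi) in HI
    by (unfold expi; simpl; ring).
  rewrite Rabs_mult, (Rabs_pos_eq r) in HI by lra.
  apply Rabs_le_between in HS. lra.
Qed.

(** * Orthogonality: integrating Taylor terms against the kernel *)

Lemma sin_2PI_mult (z : Z) (alpha : R) :
  sin (IZR z * (2 * PI) + alpha) = sin alpha.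
Proof.
  destruct (Z_le_gt_dec 0 z) as [H|H].
  - replace (IZR z * (2 * PI) + alpha)
      with (alpha + 2 * INR (Z.to_nat z) * PI)
      by (rewrite INR_IZR_INZ, Z2Nat.id by lia; ring).
    apply sin_period.
  (* [sin_period] counts periods by a natural number, so a negative [z] is cancelled by adding [- z]
     periods. *)
  - rewrite <- (sin_period _ (Z.to_nat (- z))).
    rewrite INR_IZR_INZ, Z2Nat.id, opp_IZR by lia. f_equal. ring.
Qed.

Lemma is_RInt_FTC (F f : R -> R) (a b : R) :
  (forall x, is_derive F x (f x)) -> (forall x, continuous f x) ->
  is_RInt f a b (F b - F a).
Proof.
  intros HF Hf. apply (is_RInt_derive (V := R_CompleteNormedModule)); auto.
Qed.

Lemma is_RInt_plus_scal (f g : R -> R) (a b c If Ig : R) :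
  is_RInt f a b If -> is_RInt g a b Ig ->
  is_RInt (fun x => f x + c * g x) a b (If + c * Ig).
Proof.
  intros Hf Hg. apply (is_RInt_plus (V := R_NormedModule)); [exact Hf|].
  apply (is_RInt_scal (V := R_NormedModule)), Hg.
Qed.

(** The integral of [cos (z x + alpha)] over a full period. The phase also covers sines, as cosines
    shifted by [PI / 2], and an integer [z] admits frequency differences. *)
Definition cos_integral (z : Z) (alpha : R) : R :=
  if Z.eqb z 0 then 2 * PI * cos alpha else 0.

Lemma is_RInt_cos (z : Z) (alpha : R) :
  is_RInt (fun x => cos (IZR z * x + alpha)) 0 (2 * PI) (cos_integral z alpha).
Proof.
  unfold cos_integral. destruct (Z.eqb_spec z 0) as [->|Hz].
  - replace (2 * PI * cos alpha)
      with (scal (2 * PI - 0) (cos alpha)) by (unfold scal; simpl; unfold mult; simpl; ring).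
    apply (is_RInt_ext (fun _ => cos alpha)).
    + intros x _. f_equal. ring.
    + apply @is_RInt_const.
  - assert (Hz' : IZR z <> 0) by (apply not_0_IZR; exact Hz).
    replace 0 with (sin (IZR z * (2 * PI) + alpha) / IZR z
                    - sin (IZR z * 0 + alpha) / IZR z) at 2.
    + apply (is_RInt_FTC (fun x => sin (IZR z * x + alpha) / IZR z)).
      * intros x. auto_derive; [exact I | field; exact Hz'].
      * intros x. apply (ex_derive_continuous (V := R_NormedModule)).
        auto_derive. exact I.
    + rewrite sin_2PI_mult, Rmult_0_r, Rplus_0_l. ring.
Qed.

(** Only frequency 0 survives integration, and the product has frequencies [m], [m - n] and [m + n].
    The last is never 0; the first gives the case [m = 0], the second the case [m = n], where [Re (a
    n) * cos theta + Im (a n) * sin theta] equals [Cmod (a n)]. *)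
Lemma is_RInt_im_term (a : nat -> C) (r theta : R) (m n : nat) :
  (0 < n)%nat -> is_arg (a n) theta ->
  is_RInt (fun x => im_term a r x m * (1 + sin (INR n * x + theta)))
    0 (2 * PI)
    (if Nat.eqb m 0 then 2 * PI * Im (a 0%nat)
     else if Nat.eqb m n then PI * (Cmod (a n) * r ^ n) else 0).
Proof.
  intros Hn Harg.
  set (M := Z.of_nat m); set (K := Z.of_nat n).
  set (p := r ^ m * Re (a m)); set (q := r ^ m * Im (a m)).
  (* The first two summands are the term itself; the other four are the product-to-sum expansion of
     the term times [sin (n x + theta)], with sines written as cosines of phase [- PI / 2]. *)
  assert (H : is_RInt (fun x =>
      p * cos (IZR M * x + - (PI / 2)) + q * cos (IZR M * x + 0)
      + p / 2 * cos (IZR (M - K) * x + - theta)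
      + - (p / 2) * cos (IZR (M + K) * x + theta)
      + q / 2 * cos (IZR (M + K) * x + (theta - PI / 2))
      + - (q / 2) * cos (IZR (M - K) * x + (- theta - PI / 2))) 0 (2 * PI)
      (p * cos_integral M (- (PI / 2)) + q * cos_integral M 0
      + p / 2 * cos_integral (M - K) (- theta)
      + - (p / 2) * cos_integral (M + K) theta
      + q / 2 * cos_integral (M + K) (theta - PI / 2)
      + - (q / 2) * cos_integral (M - K) (- theta - PI / 2))).
  { do 5 (apply is_RInt_plus_scal; [|apply is_RInt_cos]).
    apply (is_RInt_scal (V := R_NormedModule)), is_RInt_cos. }
  assert (Hshift : forall x, cos (x - PI / 2) = sin x).
  { intros x. rewrite cos_minus, cos_PI2, sin_PI2. ring. }
  match type of H with is_RInt _ _ _ ?v =>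
    match goal with |- is_RInt _ _ _ ?w => replace w with v end end.
  - eapply is_RInt_ext; [|exact H]. intros x _. cbv beta.
    rewrite minus_IZR, plus_IZR.
    unfold M, K. rewrite <- !INR_IZR_INZ.
    replace (INR m * x + - (PI / 2)) with (INR m * x - PI / 2) by ring.
    replace ((INR m + INR n) * x + (theta - PI / 2))
      with ((INR m + INR n) * x + theta - PI / 2) by ring.
    replace ((INR m - INR n) * x + (- theta - PI / 2))
      with ((INR m - INR n) * x - theta - PI / 2) by ring.
    rewrite !Hshift, Rplus_0_r.
    replace ((INR m - INR n) * x + - theta)
      with (INR m * x - (INR n * x + theta)) by ring.
    replace ((INR m + INR n) * x + theta)
      with (INR m * x + (INR n * x + theta)) by ring.
    replace ((INR m - INR n) * x - theta)
      with (INR m * x - (INR n * x + theta)) by ring.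
    unfold im_term. set (B := INR n * x + theta).
    rewrite cos_minus, cos_plus, sin_minus, sin_plus.
    unfold p, q.
    match goal with |- ?x = ?y => change (@eq R x y) end. field.
  - unfold cos_integral.
    replace (Z.eqb (M + K) 0) with false
      by (symmetry; apply Z.eqb_neq; unfold M, K; lia).
    replace (Z.eqb M 0) with (Nat.eqb m 0)
      by (apply eq_true_iff_eq; rewrite Nat.eqb_eq, Z.eqb_eq; unfold M; lia).
    replace (Z.eqb (M - K) 0) with (Nat.eqb m n)
      by (apply eq_true_iff_eq; rewrite Nat.eqb_eq, Z.eqb_eq;
          unfold M, K; lia).
    rewrite Hshift, sin_neg, !cos_neg, cos_PI2, cos_0.
    destruct (Nat.eqb_spec m 0) as [E|E].
    + destruct (Nat.eqb_spec m n) as [E'|E']; [lia|].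
      unfold p, q. rewrite E. simpl. ring.
    + destruct (Nat.eqb_spec m n) as [E'|E']; [|ring].
      assert (Hp : Re (a n) = Cmod (a n) * cos theta).
      { rewrite Harg at 1. unfold expi. simpl. ring. }
      assert (Hq : Im (a n) = Cmod (a n) * sin theta).
      { rewrite Harg at 1. unfold expi. simpl. ring. }
      unfold p, q. rewrite E', Hp, Hq.
      replace (PI * (Cmod (a n) * r ^ n)) with
        (PI * (Cmod (a n) * r ^ n) * (Rsqr (sin theta) + Rsqr (cos theta)))
        by (rewrite sin2_cos2; ring).
      unfold Rsqr. field.
Qed.

Lemma is_RInt_im_term_sum (a : nat -> C) (r theta : R) (n N : nat) :
  (0 < n)%nat -> (n <= N)%nat -> is_arg (a n) theta ->
  is_RInt (fun x => sum_n (im_term a r x) N * (1 + sin (INR n * x + theta)))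
    0 (2 * PI) (2 * PI * Im (a 0%nat) + PI * (Cmod (a n) * r ^ n)).
Proof.
  intros Hn HN Harg.
  set (v := PI * (Cmod (a n) * r ^ n)).
  (* Induction has to start at 0, below [n], so the value records whether degree [n] has been
     reached yet. *)
  enough (H : forall N,
    is_RInt (fun x => sum_n (im_term a r x) N * (1 + sin (INR n * x + theta)))
      0 (2 * PI) (2 * PI * Im (a 0%nat) + if Nat.leb n N then v else 0)).
  { specialize (H N). apply Nat.leb_le in HN. rewrite HN in H. exact H. }
  clear N HN. intros N.
  induction N as [|N IH].
  - assert (H := is_RInt_im_term a r theta 0 n Hn Harg). simpl Nat.eqb in H.
    replace (Nat.leb n 0) with false by (symmetry; apply Nat.leb_gt; lia).
    rewrite Rplus_0_r. eapply is_RInt_ext; [|exact H].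
    intros x _. cbv beta. now rewrite sum_O.
  - assert (H := is_RInt_im_term a r theta (S N) n Hn Harg).
    simpl (Nat.eqb (S N) 0) in H. fold v in H.
    assert (H2 := is_RInt_plus (V := R_NormedModule) _ _ _ _ _ _ IH H).
    match type of H2 with is_RInt _ _ _ ?v =>
      match goal with |- is_RInt _ _ _ ?w => replace w with v end end.
    + eapply is_RInt_ext; [|exact H2]. intros x _. cbv beta.
      rewrite sum_Sn. unfold plus; simpl. ring.
    + match goal with |- plus ?x ?y = ?z => change (@eq R (x + y) z) end.
      destruct (Nat.leb_spec n N), (Nat.leb_spec n (S N)),
        (Nat.eqb_spec (S N) n); try lia; ring.
Qed.

(** * The explicit integral of the majorant *)

(** Since [sin] changes sign at [PI], the integral is [(F PI - F 0) - (F (2 * PI) - F PI)]. *)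
Lemma is_RInt_abs_sin (F f : R -> R) :
  (forall x, is_derive F x (sin x * f x)) -> (forall x, continuous f x) ->
  is_RInt (fun x => Rabs (sin x) * f x) 0 (2 * PI)
    (2 * F PI - F 0 - F (2 * PI)).
Proof.
  intros HF Hf.
  assert (Hpi := PI_RGT_0).
  assert (Hc : forall x, continuous (fun x => sin x * f x) x).
  { intros x. apply (continuous_mult (K := R_AbsRing)); [|apply Hf].
    apply continuous_sin. }
  replace (2 * F PI - F 0 - F (2 * PI))
    with (plus (F PI - F 0) (opp (F (2 * PI) - F PI)))
    by (unfold plus, opp; simpl; ring).
  apply (is_RInt_Chasles (V := R_NormedModule)) with PI.
  - eapply is_RInt_ext; [|apply (is_RInt_FTC F _ 0 PI HF Hc)].
    rewrite Rmin_left, Rmax_right by lra. intros x Hx. cbv beta.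
    rewrite Rabs_pos_eq; [reflexivity | apply sin_ge_0; lra].
  - eapply is_RInt_ext;
      [|apply (is_RInt_opp (V := R_NormedModule)),
              (is_RInt_FTC F _ PI (2 * PI) HF Hc)].
    rewrite Rmin_left, Rmax_right by lra. intros x Hx.
    unfold opp; simpl.
    rewrite Rabs_left1; [ring | apply sin_le_0; lra].
Qed.

Lemma sin_INR_PI (n : nat) (theta : R) :
  sin (INR n * PI + theta) = (-1) ^ n * sin theta.
Proof.
  induction n as [|n IH].
  - simpl. rewrite Rmult_0_l, Rplus_0_l. ring.
  - rewrite S_INR.
    replace ((INR n + 1) * PI + theta) with (INR n * PI + theta + PI) by ring.
    rewrite neg_sin, IH. simpl. ring.
Qed.

(** The product [sin x * sin (n x + theta)] has frequencies [n - 1] and [n + 1], and its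
    antiderivative divides by both; [n = 1] therefore needs its own antiderivative. The factor
    [1 + (-1) ^ n] comes from the values at [PI]. *)
Lemma is_RInt_abs_sin_kernel (n : nat) (theta : R) :
  (0 < n)%nat ->
  is_RInt (fun x => Rabs (sin x) * (1 + sin (INR n * x + theta))) 0 (2 * PI)
    (2 * first_fraction n theta).
Proof.
  intros Hn.
  assert (Hc : forall x, continuous (fun x => 1 + sin (INR n * x + theta)) x).
  { intros x. apply (ex_derive_continuous (V := R_NormedModule)).
    auto_derive. exact I. }
  unfold first_fraction. destruct (Nat.eqb_spec n 1) as [->|H1].
  (* At frequency 0 the antiderivative is the linear term [x * cos theta / 2], which cancels in
     [2 * F PI - F 0 - F (2 * PI)]. *)
  - set (F := fun x =>
      - cos x + (x * cos theta / 2 - sin (2 * x + theta) / 4)).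
    replace (2 * 2) with (2 * F PI - F 0 - F (2 * PI)).
    + apply is_RInt_abs_sin; [|exact Hc].
      intros x. unfold F. auto_derive; [exact I|].
      change (INR 1) with 1. rewrite !Rmult_1_l.
      assert (E : cos theta = cos (x + theta) * cos x + sin (x + theta) * sin x).
      { rewrite <- cos_minus. f_equal. ring. }
      rewrite E. replace (2 * x + theta) with (x + theta + x) by ring.
      set (B := x + theta). rewrite cos_plus. field.
    + unfold F.
      replace (2 * (2 * PI) + theta) with (INR 4 * PI + theta) by (simpl; ring).
      replace (2 * PI + theta) with (INR 2 * PI + theta) by (simpl; ring).
      rewrite !sin_INR_PI, cos_PI, cos_0, cos_2PI, Rmult_0_r, Rplus_0_l.
      simpl. field.
  - destruct n as [|[|n]]; [lia|lia|]. clear Hn H1.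
    assert (HI : 0 <= INR n) by apply pos_INR.
    assert (E1 : INR (S (S n)) = INR n + 2) by (rewrite !S_INR; ring).
    remember (INR (S n)) as u eqn:Eu.
    remember (INR (S (S (S n)))) as v eqn:Ev.
    (* The index is now [n + 2], so [u = n + 1] and [v = n + 3] are the two neighbouring
       frequencies; their product is the denominator [(n + 2) ^ 2 - 1]. *)
    set (F := fun x =>
      - cos x + / 2 * (sin (u * x + theta) / (INR n + 1)
                       - sin (v * x + theta) / (INR n + 3))).
    match goal with |- is_RInt _ _ _ ?w =>
      replace w with (2 * F PI - F 0 - F (2 * PI)) end.
    + apply is_RInt_abs_sin; [|exact Hc].
      intros x. unfold F. auto_derive; [exact I|].
      rewrite Eu, Ev, !S_INR.
      replace ((INR n + 1) * x + theta)
        with ((INR n + 1 + 1) * x + theta - x) by ring.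
      replace ((INR n + 1 + 1 + 1) * x + theta)
        with ((INR n + 1 + 1) * x + theta + x) by ring.
      set (B := (INR n + 1 + 1) * x + theta).
      rewrite cos_minus, cos_plus. field. lra.
    + unfold F. rewrite Eu, Ev, !sin_INR_PI, cos_PI, cos_0, cos_2PI.
      rewrite !Rmult_0_r, !Rplus_0_l.
      rewrite !(INR_IZR_INZ (S _)), !sin_2PI_mult, <- !INR_IZR_INZ, E1.
      simpl pow. field. nra.
Qed.

(** * The coefficient bound inside the disk and its limit at the boundary *)

Lemma coef_bound_radius (a : nat -> C) (omega : C -> C) (rho r theta : R)
  (n : nat) :
  taylor_on_disk a omega rho ->
  (forall k : C, Cmod k < rho -> Im (omega k) <= Rabs (Im k)) ->
  0 < r < rho -> (0 < n)%nat -> is_arg (a n) theta ->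
  2 * PI * Im (a 0%nat) + PI * (Cmod (a n) * r ^ n)
  <= r * (2 * first_fraction n theta).
Proof.
  intros HT Him Hr Hn Harg. assert (Hpi := PI_RGT_0).
  apply le_epsilon. intros e He.
  (* The kernel has integral [2 * PI], so an excess of [e / (2 * PI)] in the pointwise bound costs
     exactly [e]. *)
  destruct (im_term_partial_sum_le a omega rho r (e / (2 * PI)) n HT Him Hr)
    as [N [HN HB]].
  { apply Rdiv_lt_0_compat; lra. }
  assert (HL := is_RInt_im_term_sum a r theta n N Hn HN Harg).
  assert (H1 : is_RInt (fun x => 1 + sin (INR n * x + theta)) 0 (2 * PI)
                 (2 * PI)).
  (* The constant 1 is taken as a cosine of frequency 0 and the sine as a shifted cosine of
     frequency [n], which integrates to 0. *)
  { assert (H := is_RInt_plus (V := R_NormedModule) _ _ _ _ _ _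
      (is_RInt_cos 0 0) (is_RInt_cos (Z.of_nat n) (theta - PI / 2))).
    unfold cos_integral in H.
    destruct (Z.eqb_spec (Z.of_nat n) 0); [lia|]. simpl Z.eqb in H.
    rewrite cos_0 in H. unfold plus in H; simpl in H.
    replace (2 * PI) with (2 * PI * 1 + 0) at 2 by ring.
    eapply is_RInt_ext; [|exact H]. intros x _. cbv beta.
    rewrite Rmult_0_l, Rplus_0_l, cos_0, <- INR_IZR_INZ.
    replace (INR n * x + (theta - PI / 2))
      with (INR n * x + theta - PI / 2) by ring.
    rewrite (cos_minus _ (PI / 2)), cos_PI2, sin_PI2.
    match goal with |- ?x = ?y => change (@eq R x y) end. ring. }
  assert (HR := is_RInt_plus (V := R_NormedModule) _ _ _ _ _ _
    (is_RInt_scal (V := R_NormedModule) _ _ _ r _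
       (is_RInt_abs_sin_kernel n theta Hn))
    (is_RInt_scal (V := R_NormedModule) _ _ _ (e / (2 * PI)) _ H1)).
  unfold plus, scal in HR; simpl in HR; unfold mult in HR; simpl in HR.
  replace e with (e / (2 * PI) * (2 * PI)) at 1 by (field; lra).
  eapply is_RInt_le; [|exact HL|exact HR|]; [lra|].
  intros x _. cbv beta.
  assert (0 <= 1 + sin (INR n * x + theta))
    by (generalize (SIN_bound (INR n * x + theta)); lra).
  specialize (HB x).
  rewrite <- (Rmult_assoc r), <- Rmult_plus_distr_r.
  apply Rmult_le_compat_r; assumption.
Qed.

Lemma le_of_le_left (f : R -> R) (b : R) :
  0 < b -> continuous f b -> (forall r, 0 < r < b -> f r <= 0) -> f b <= 0.
Proof.
  intros Hb Hf H. apply Rnot_lt_le. intros Hpos.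
  destruct (Hf _ (open_gt 0 (f b) Hpos)) as [d Hd].
  assert (Hd0 := cond_pos d).
  (* This point lies within [d] of [b], where [f] is positive, and also strictly between 0 and
     [b]. *)
  set (r := Rmax (b / 2) (b - d / 2)).
  assert (Hr : b / 2 <= r /\ b - d / 2 <= r)
    by (split; [apply Rmax_l | apply Rmax_r]).
  assert (Hr' : r < b) by (apply Rmax_lub_lt; lra).
  specialize (H r ltac:(lra)).
  assert (0 < f r); [|lra].
  apply Hd. apply Rabs_def1; unfold minus, plus, opp; simpl; lra.
Qed.

Theorem theorem1 (rho : R) (omega : C -> C) (a : nat -> C)
  (hrho : 0 < rho)
  (hanalytic : analytic_on_disk omega rho)
  (htaylor : taylor_on_disk a omega rho)
  (him : forall k : C, Cmod k < rho -> Im (omega k) <= Rabs (Im k)) :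
  Im (a 0%nat) <= 0 /\
  forall n : nat, (0 < n)%nat ->
    forall theta : R, is_arg (a n) theta ->
      Cmod (a n) <=
        first_fraction n theta * (2 / (PI * rho ^ (n - 1)))
        - 2 * Im (a 0%nat) / rho ^ n.
Proof.
  split.
  - assert (H0 : Cmod (RtoC 0) < rho) by (rewrite Cmod_0; exact hrho).
    (* At 0 the Taylor series sums to [a 0], so [omega 0 = a 0] by uniqueness of limits, and the
       hypothesis there reads [Im (omega 0) <= 0]. *)
    rewrite <- (filterlim_locally_unique _ _ _ (htaylor _ H0) (is_pseries_0 a)).
    eapply Rle_trans; [exact (him _ H0)|].
    simpl. rewrite Rabs_R0. lra.
  - intros n Hn theta Harg. assert (Hpi := PI_RGT_0).
    (* With denominators cleared the bound is polynomial in [r], hence continuous up to [rho],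
       although [omega] is controlled only inside the disk. *)
    assert (H := le_of_le_left (fun r =>
      2 * PI * Im (a 0%nat) + PI * (Cmod (a n) * r ^ n)
      - r * (2 * first_fraction n theta)) rho hrho).
    cbv beta in H.
    assert (H' : 2 * PI * Im (a 0%nat) + PI * (Cmod (a n) * rho ^ n)
                 <= rho * (2 * first_fraction n theta)).
    { apply Rminus_le, H.
      - apply (ex_derive_continuous (V := R_NormedModule)).
        auto_derive. exact I.
      - intros r Hr. apply Rle_minus.
        apply (coef_bound_radius a omega rho); assumption. }
    (* Writing the index as a successor removes the truncated subtraction in the exponent
       [n - 1]. *)
    destruct n as [|n]; [lia|].
    replace (S n - 1)%nat with n by lia. simpl pow in *.
    assert (0 < rho ^ n) by (apply pow_lt; lra).
    apply (Rmult_le_reg_r (PI * (rho * rho ^ n))).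
    { do 2 (apply Rmult_lt_0_compat; [lra|]). assumption. }
    replace ((first_fraction (S n) theta * (2 / (PI * rho ^ n)) -
       2 * Im (a 0%nat) / (rho * rho ^ n)) * (PI * (rho * rho ^ n)))
      with (rho * (2 * first_fraction (S n) theta) - 2 * PI * Im (a 0%nat))
      by (field; lra).
    lra.
Qed.
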